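(* Let $G$ be a graph such that $d_u+d_v\ge 6$ for every edge $uv$ of $G$, and let $k\ge 2$. If $\lambda_{k(1)}\le \frac{n_k-1}{2}$, then $\overline{\mathcal{L}^k(G)}$ is hyperenergetic.
   Context: $d_u$ is the degree of $u$; $\mathcal{L}^k(G)$ is the $k$-th iterated line graph, of order $n_k$, with largest adjacency eigenvalue $\lambda_{k(1)}$; $\overline{X}$ is the complement. The energy of a graph is the sum of absolute values of its adjacency eigenvalues; a graph of order $N$ is hyperenergetic if its energy exceeds $\mathcal{E}(K_N)=2(N-1)$. *)

(* Defs.v *)
From HB Require Import structures.
From mathcomp Require Import all_boot all_order all_algebra.
From mathcomp Require Import polyrcf.

Set Implicit Arguments.
Unset Strict Implicit.
Unset Printing Implicit Defensive.

Import Order.TTheory GRing.Theory Num.Theory.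

Local Open Scope ring_scope.

Record sgraph := SGraph {
  vertex : finType;
  adj : rel vertex;
  adj_sym : symmetric adj;
  adj_irr : irreflexive adj
}.

Definition graph_order (G : sgraph) : nat := #|vertex G|.

Definition degree (G : sgraph) (u : vertex G) : nat := #|[set v | adj u v]|.

Section Complement.
Variable G : sgraph.

Definition compl_adj : rel (vertex G) := fun u v => (u != v) && ~~ adj u v.

Lemma compl_adj_sym : symmetric compl_adj.
Proof. by move=> u v; rewrite /compl_adj eq_sym adj_sym. Qed.

Lemma compl_adj_irr : irreflexive compl_adj.
Proof. by move=> u; rewrite /compl_adj eqxx. Qed.

Definition complement : sgraph := SGraph compl_adj_sym compl_adj_irr.

End Complement.

Section LineGraph.
Variable G : sgraph.

Definition edges : {set {set vertex G}} :=
  [set [set p.1; p.2] | p : vertex G * vertex G & adj p.1 p.2].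

Definition edge : finType := {e : {set vertex G} | e \in edges}.

Definition line_adj : rel edge :=
  fun e f => (e != f) && (val e :&: val f != set0).

Lemma line_adj_sym : symmetric line_adj.
Proof. by move=> e f; rewrite /line_adj eq_sym setIC. Qed.

Lemma line_adj_irr : irreflexive line_adj.
Proof. by move=> e; rewrite /line_adj eqxx. Qed.

Definition line_graph : sgraph := SGraph line_adj_sym line_adj_irr.

End LineGraph.

Definition iter_line_graph (k : nat) (G : sgraph) : sgraph :=
  iter k line_graph G.

Section Spectrum.
Variable R : rcfType.

Definition adjmx (G : sgraph) : 'M[R]_(graph_order G) :=
  \matrix_(i, j) (adj (enum_val i) (enum_val j))%:R.

(* The roots in R of the characteristic polynomial, each repeated according   *)
(* to its multiplicity, in nonincreasing order ([rootsR] is increasing). For  *)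
(* a symmetric matrix this list has length n.                                 *)
Definition eigenvalues n (A : 'M[R]_n) : seq R :=
  rev (flatten [seq nseq (mup x (char_poly A)) x | x <- rootsR (char_poly A)]).

(* Junk value 0 for the graph without vertices.                               *)
Definition lambda1 (G : sgraph) : R := head 0 (eigenvalues (adjmx G)).

Definition energy (G : sgraph) : R :=
  \sum_(x <- eigenvalues (adjmx G)) `|x|.

Definition hyperenergetic (G : sgraph) : Prop :=
  2 * ((graph_order G)%:R - 1) < energy G.

End Spectrum.

(* Main.v *)
(** The graph X = L^k(G) is the line graph of H = L^(k-1)(G), and the hypothesis
    on G gives H minimum degree at least 4, so X has order N >= 2 |H|.  If B is
    the edge-vertex incidence matrix of H, then A(X) = B B^T - 2, so every vector
    of the kernel of x |-> x B is an eigenvector of X for -2.  It is moreover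
    orthogonal to the all-ones vector, since each row of B sums to 2; hence it is
    an eigenvector of the complement for 1.  This kernel has dimension at least
    N - |H| >= N / 2, and the Rayleigh quotient of the complement at the all-ones
    vector is at least N - 1 - lambda_1(X) >= (N - 1) / 2.  As the eigenvalues sum
    to 0, the energy is at least 2 (N / 2 + (N - 1) / 2) = 2 N - 1.

    The last step is carried out as a duality: the energy of a symmetric matrix A
    is at least tr (A M) for every orthogonal M, which avoids all bookkeeping of
    eigenvalue multiplicities. *)

Require Import Defs.
From HB Require Import structures.
From mathcomp Require Import all_boot all_order all_algebra.
From mathcomp Require Import polyrcf complex zify lra.

Set Implicit Arguments.
Unset Strict Implicit.
Unset Printing Implicit Defensive.

Import Order.TTheory GRing.Theory Num.Theory.

Local Open Scope ring_scope.

(** * Eigenvalue lists and the spectral theorem for real symmetric matrices *)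

Lemma count_flatten_nseq (T : eqType) (m : T -> nat) (r : seq T) (x : T) :
  uniq r -> count_mem x (flatten [seq nseq (m y) y | y <- r]) =
            if x \in r then m x else 0%N.
Proof.
elim: r => //= y r IHr /andP[yNr ur].
rewrite count_cat IHr // count_nseq inE /= eq_sym.
by case: eqVneq => [->|_]; rewrite ?(negPf yNr) ?mul1n ?addn0.
Qed.

Lemma sorted_flatten_nseq (R : numDomainType) (m : R -> nat) (r : seq R) :
  sorted <%R r -> sorted <=%R (flatten [seq nseq (m x) x | x <- r]).
Proof.
rewrite (sorted_pairwise lt_trans) (sorted_pairwise le_trans).
elim: r => //= x r IHr /andP[/allP xr /IHr pr].
rewrite pairwise_cat pr andbT; apply/andP; split.
  apply/allrelP => y z /nseqP[-> _] /flatten_mapP[t tr /nseqP[-> _]].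
  exact/ltW/xr.
elim: (m x) => //= n ->; rewrite andbT.
by apply/allP => y /nseqP[-> _].
Qed.

Section Eigenvalues.
Variable R : rcfType.

(** In each list a number occurs as often as its multiplicity as a root of [char_poly A]. *)
Lemma eigenvalues_perm n (A : 'M[R]_n) (s : seq R) :
  char_poly A = \prod_(x <- s) ('X - x%:P) -> perm_eq (eigenvalues A) s.
Proof.
move=> cA; rewrite /eigenvalues perm_rev; apply/allP => x _ /=; apply/eqP.
have pN0 : char_poly A != 0 by rewrite monic_neq0 ?char_poly_monic.
rewrite count_flatten_nseq ?uniq_roots //.
rewrite -roots_on_rootsR // in_itv /= cA mu_prod_XsubC root_prod_XsubC.
by case: ifPn => // /count_memPn.
Qed.

Lemma le_head_eigenvalues n (A : 'M[R]_n) (x : R) :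
  x \in eigenvalues A -> x <= head 0 (eigenvalues A).
Proof.
have : sorted >=%R (eigenvalues A).
  by rewrite /eigenvalues rev_sorted; apply/sorted_flatten_nseq/sorted_roots.
case: (eigenvalues A) => //= y s; rewrite path_sortedE; last exact: ge_trans.
by case/andP => /allP ys _; rewrite inE => /predU1P[->//|/ys].
Qed.

Local Open Scope complex_scope.
Local Open Scope sesquilinear_scope.

Local Notation toC := (map_mx (real_complex R)).

Lemma toC_tr m n (A : 'M[R]_(m, n)) : (toC A)^t* = toC A^T.
Proof.
apply/matrixP => i j; rewrite !mxE.
by apply/CrealP/complex_realP; exists (A j i).
Qed.

(** Over [R[i]] the matrix is Hermitian, hence unitarily diagonalizable with real diagonal. Its
    characteristic polynomial therefore splits, and the factorization descends to [R] because the
    embedding is injective. *)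
Lemma symmetric_spectral n (A : 'M[R]_n) : A^T = A ->
  exists U : 'M[R[i]]_n, exists d : 'I_n -> R,
  [/\ U \is unitarymx, toC A = U^t* *m diag_mx (\row_i (d i)%:C) *m U
    & perm_eq (eigenvalues A) [seq d i | i <- enum 'I_n]].
Proof.
move=> Asym; pose AC := toC A.
have AC_herm : AC \is hermsymmx.
  by apply/is_hermitianmxP; rewrite expr0 scale1r toC_tr Asym.
have Uu := spectral_unitarymx AC.
have Aeq :
    AC = (spectralmx AC)^t* *m diag_mx (spectral_diag AC) *m spectralmx AC.
  rewrite -invmx_unitary //.
  exact/orthomx_spectralP/hermitian_normalmx.
have /mxOverP dreal := hermitian_spectral_diag_real AC_herm.
pose d i := complex.Re (spectral_diag AC 0 i).
have dE : spectral_diag AC = \row_i (d i)%:C.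
  by apply/rowP => i; rewrite mxE RRe_real.
exists (spectralmx AC), d; split; rewrite -?dE //.
apply: eigenvalues_perm; apply: (@map_poly_inj _ _ (real_complex R)).
rewrite big_map big_enum rmorph_prod /= map_char_poly -/AC.
pose U := spectralmx AC.
have Uunit : U \in unitmx by apply: spectral_unit.
have -> : char_poly AC = char_poly (diag_mx (\row_i (d i)%:C)).
  rewrite -dE {1}Aeq -/U -invmx_unitary // /char_poly.
  have -> : char_poly_mx (invmx U *m diag_mx (spectral_diag AC) *m U) =
      map_mx polyC (invmx U) *m char_poly_mx (diag_mx (spectral_diag AC))
       *m map_mx polyC U.
    rewrite /char_poly_mx !map_mxM mulmxBr mulmxBl; congr (_ - _).
    by rewrite scalar_mxC -mulmxA -map_mxM mulVmx // map_mx1 mulmx1.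
  by rewrite !det_mulmx mulrAC -det_mulmx -map_mxM mulVmx // map_mx1 det1 mul1r.
rewrite char_poly_trig ?diag_mx_is_trig //.
apply: eq_bigr => i _.
by rewrite !mxE eqxx mulr1n rmorphB /= map_polyX map_polyC.
Qed.

(* With A = U^* D U, the trace of A M is the sum of the d_i w_i, where the w_i
   are the diagonal entries of the unitary matrix U M U^*, hence |w_i| <= 1. *)
Lemma trace_orthogonal_le n (A M : 'M[R]_n) : A^T = A -> M *m M^T = 1%:M ->
  \tr (A *m M) <= \sum_(x <- eigenvalues A) `|x|.
Proof.
move=> /symmetric_spectral[U [d [Uu AE Aperm]]] MM.
rewrite (perm_big _ Aperm) /= big_map big_enum /= -lecR.
have Mu : toC M \is unitarymx.
  by apply/unitarymxP; rewrite toC_tr -map_mxM MM map_mx1.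
pose W := U *m toC M *m U^t*.
have Wu : W \is unitarymx.
  by rewrite /W !mul_unitarymx // trmxC_unitary.
have W1 i : `|W i i| <= 1.
  move/unitarymxP/matrixP/(_ i i): Wu; rewrite !mxE eqxx (bigD1 i) //= => We.
  rewrite -(@ler_pXn2r _ 2) ?nnegrE // expr1n normCK -[leRHS]We !mxE lerDl.
  by apply: sumr_ge0 => j _; rewrite !mxE mul_conjC_ge0.
have trE : (\tr (A *m M))%:C = \sum_i (d i)%:C * W i i.
  rewrite -[LHS](trace_map_mx (real_complex R)) map_mxM AE -!mulmxA mxtrace_mulC.
  rewrite -mulmxA -/W /mxtrace; apply: eq_bigr => i _.
  by rewrite mul_diag_mx mxE [(\row_j _) _ _]mxE.
have treal : (\tr (A *m M))%:C <= `|(\tr (A *m M))%:C|.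
  by rewrite real_ler_norm //; apply/complex_realP; eexists.
apply: (le_trans treal); rewrite trE; apply: (le_trans (ler_norm_sum _ _ _)).
rewrite rmorph_sum /=; apply: ler_sum => i _.
rewrite normrM (_ : `|(d i)%:C| = `|d i|%:C) ?ler_piMr ?ler0c //.
by rewrite normc_def /= expr0n addr0 sqrtr_sqr.
Qed.

(** Rayleigh bound: in the coordinates [w] of [v] in an eigenbasis, the form is a sum of terms
    [d i * |w 0 i|^2], and no [d i] exceeds the head of the list. *)
Lemma quadratic_form_le n (A : 'M[R]_n) (v : 'rV[R]_n) : A^T = A ->
  (v *m A *m v^T) 0 0 <= head 0 (eigenvalues A) * (v *m v^T) 0 0.
Proof.
move=> /symmetric_spectral[U [d [Uu AE Aperm]]]; rewrite -lecR rmorphM /=.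
pose w := toC v *m U^t*.
have toCE m p (B : 'M[R]_(m, p)) i j : (B i j)%:C = toC B i j by rewrite mxE.
have wT : U *m toC v^T = w^t*.
  by rewrite /w trmx_mul map_mxM -toC_tr trmxCK.
have -> : ((v *m A *m v^T) 0 0)%:C = \sum_i (d i)%:C * `|w 0 i| ^+ 2.
  rewrite toCE !map_mxM AE !mulmxA -mulmxA wT -/w mxE.
  apply: eq_bigr => i _.
  by rewrite mul_mx_diag !mxE normCK mulrAC mulrC mulrA.
have -> : ((v *m v^T) 0 0)%:C = \sum_i `|w 0 i| ^+ 2.
  rewrite toCE !map_mxM -[toC v]mulmx1 -(mulVmx (unitarymx_unit Uu)).
  rewrite invmx_unitary // mulmxA -/w -mulmxA wT mxE.
  by apply: eq_bigr => i _; rewrite !mxE normCK.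
rewrite mulr_sumr; apply: ler_sum => i _; apply: ler_wpM2r.
  by rewrite exprn_ge0.
rewrite lecR; apply: le_head_eigenvalues; rewrite (perm_mem Aperm).
by apply: map_f; rewrite mem_enum.
Qed.

End Eigenvalues.

(** * Edge counts and degrees in line graphs *)

Section Edges.
Variable G : sgraph.

Lemma pair_edge (u v : vertex G) :
  adj u v -> exists e : edge G, val e = [set u; v].
Proof.
move=> uv; have uvE : [set u; v] \in edges G.
  by apply/imsetP; exists (u, v); rewrite ?inE.
by exists (exist (fun e => e \in edges G) _ uvE).
Qed.

Lemma edge_pair (e : edge G) : exists u v, adj u v /\ val e = [set u; v].
Proof. by case: e => e /= /imsetP[[u v]]; rewrite inE => uv ->; exists u, v. Qed.

Lemma adj_neq (u v : vertex G) : adj u v -> u != v.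
Proof. by apply: contraTneq => ->; rewrite adj_irr. Qed.

Lemma card_edge (e : edge G) : #|val e| = 2%N.
Proof. by have [u [v [/adj_neq uv ->]]] := edge_pair e; rewrite cards2 uv. Qed.

Lemma pair_inj (u v w : vertex G) : [set u; v] = [set u; w] -> v = w.
Proof.
move=> e; have : v \in [set u; w] by rewrite -e set22.
have : w \in [set u; v] by rewrite e set22.
by rewrite !inE => /orP[]/eqP-> // /orP[]/eqP.
Qed.

(** An edge is determined by its vertex set, so distinct sets [f x] come from distinct edges. Lower
    bounds on numbers of edges are obtained this way. *)
Lemma card_edges_ge (T : finType) (D : {set T}) (f : T -> {set vertex G})
    (Q : pred (edge G)) :
  {in D &, injective f} ->
  (forall x, x \in D -> exists2 e : edge G, val e = f x & Q e) ->
  (#|D| <= #|[set e | Q e]|)%N.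
Proof.
move=> finj fQ; rewrite -(card_in_imset finj).
rewrite -(card_imset (mem [set e | Q e]) val_inj) subset_leq_card //.
apply/subsetP => _ /imsetP[x xD ->]; have [e <- Qe] := fQ x xD.
by apply: imset_f; rewrite inE.
Qed.

Lemma degree_le_incident (v : vertex G) :
  (degree v <= #|[set e : edge G | v \in val e]|)%N.
Proof.
apply: (@card_edges_ge _ _ (fun w => [set v; w])) => [w w' _ _ /pair_inj //|w].
by rewrite inE => /pair_edge[e eE]; exists e; rewrite ?eE ?set21.
Qed.

(** Double counting of incidences: every edge has two vertices. *)
Lemma sum_incident :
  (\sum_v #|[set e : edge G | v \in val e]| = 2 * graph_order (line_graph G))%N.
Proof.
under eq_bigr do rewrite -sum1dep_card big_mkcond /=.
rewrite exchange_big /= mulnC -sum_nat_const.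
by apply: eq_bigr => e _; rewrite -big_mkcond /= sum1_card card_edge.
Qed.

(** Besides [e] there are [degree u - 1] edges at [u] and [degree v - 1] at [v]. All of them meet
    [e], and none is counted twice, since only [e] contains both ends. *)
Lemma line_degree_ge (e : edge G) (u v : vertex G) :
  adj u v -> val e = [set u; v] ->
  (degree u + degree v <= @degree (line_graph G) e + 2)%N.
Proof.
move=> uv eE; have uDv := adj_neq uv.
pose Nu := [set w | adj u w] :\ v; pose Nv := [set w | adj v w] :\ u.
have du : degree u = #|Nu|.+1 by rewrite /degree (cardsD1 v) inE uv.
have dv : degree v = #|Nv|.+1 by rewrite /degree (cardsD1 u) inE adj_sym uv.
pose f (x : vertex G + vertex G) :=
  match x with inl w => [set u; w] | inr w => [set v; w] end.
pose D := [set x : vertex G + vertex G |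
             match x with inl w => w \in Nu | inr w => w \in Nv end].
have -> : (degree u + degree v = #|D| + 2)%N.
  rewrite du dv addSn addnS -addn2; congr addn.
  rewrite -[#|D|]sum1_card big_sumType /= -!sum1_card.
  by congr addn; apply: eq_bigl => w; rewrite !inE.
rewrite leq_add2r; apply: (@card_edges_ge _ _ f).
  move=> [w|w] [w'|w']; rewrite !inE => /andP[wv _] /andP[w'u _] /=.
  - by move/pair_inj->.
  - move=> E; have : u \in [set v; w'] by rewrite -E set21.
    by rewrite !inE (negPf uDv) eq_sym (negPf w'u).
  - move=> E; have : v \in [set u; w'] by rewrite -E set21.
    by rewrite !inE eq_sym (negPf uDv) eq_sym (negPf w'u).
  - by move/pair_inj->.
have sharing a b w : adj a w -> w != b -> [set u; v] = [set a; b] ->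
    exists2 e', val e' = [set a; w] & line_adj e e'.
  move=> /pair_edge[e' e'E] wb ab; exists e' => //.
  rewrite /line_adj -val_eqE eE e'E ab; apply/andP; split.
    by apply/eqP => /pair_inj bw; rewrite bw eqxx in wb.
  by apply/set0Pn; exists a; rewrite !inE eqxx.
move=> [w|w]; rewrite !inE => /andP[wN aw] /=; first exact: sharing aw wN _.
by apply: sharing aw wN _; rewrite setUC.
Qed.

(** The incidences number twice the edges, and each vertex contributes at least 4 of them. *)
Lemma line_order_ge :
  (forall v : vertex G, 4 <= degree v)%N ->
  (2 * graph_order G <= graph_order (line_graph G))%N.
Proof.
move=> deg4; rewrite -(@leq_pmul2l 2) // -sum_incident mulnA.
rewrite /graph_order mulnC -sum_nat_const leq_sum // => v _.
exact: leq_trans (deg4 v) (degree_le_incident v).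
Qed.

End Edges.

Lemma line_degree_ge4 (G : sgraph) :
  (forall u v : vertex G, adj u v -> 6 <= degree u + degree v)%N ->
  forall e : vertex (line_graph G), (4 <= degree e)%N.
Proof.
move=> deg6 e; have [u [v [uv eE]]] := edge_pair e.
by rewrite -(leq_add2r 2) (leq_trans (deg6 _ _ uv)) // line_degree_ge.
Qed.

Lemma iter_line_degree_ge4 (G : sgraph) (k : nat) :
  (forall u v : vertex G, adj u v -> 6 <= degree u + degree v)%N ->
  forall e : vertex (iter_line_graph k.+1 G), (4 <= degree e)%N.
Proof.
(* The degree-sum condition passes from each line graph to the next because 4 + 4 >= 6. *)
move=> deg6; elim: k => [|k IHk]; apply: line_degree_ge4 => // u v _.
by rewrite (leq_trans _ (leq_add (IHk u) (IHk v))).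
Qed.

(** * Adjacency and incidence matrices, and the energy bound *)

Section Matrices.
Variable R : rcfType.

Lemma adjmx_sym (G : sgraph) : (adjmx R G)^T = adjmx R G.
Proof. by apply/matrixP => i j; rewrite !mxE adj_sym. Qed.

Lemma adjmx_tr0 (G : sgraph) : \tr (adjmx R G) = 0.
Proof. by rewrite /mxtrace big1 // => i _; rewrite mxE adj_irr. Qed.

Lemma adjmx_complement (G : sgraph) :
  adjmx R (complement G) = const_mx 1 - 1%:M - adjmx R G.
Proof.
apply/matrixP => i j; rewrite !mxE /= /compl_adj (inj_eq enum_val_inj).
case: eqVneq => [->|_] /=; first by rewrite adj_irr subrr subr0.
by case: adj; rewrite ?subr0 ?subrr.
Qed.

Definition incmx (G : sgraph) :
    'M[R]_(graph_order (line_graph G), graph_order G) :=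
  \matrix_(i, j) (enum_val j \in val (enum_val i : edge G))%:R.

Lemma sum_mem_enum_val (T : finType) (A : {set T}) :
  \sum_(j < #|T|) (enum_val j \in A)%:R = #|A|%:R :> R.
Proof.
rewrite -natr_sum; congr (_%:R).
rewrite -sum1_card [RHS]big_mkcond /=.
rewrite [RHS](reindex_onto enum_val enum_rank) /=; last first.
  by move=> x _; rewrite enum_rankK.
by apply: eq_big => [j|j _]; rewrite ?enum_valK ?eqxx //; case: (_ \in A).
Qed.

Lemma incmx_const1 (G : sgraph) (m : nat) :
  incmx G *m const_mx 1 = const_mx 2 :> 'M_(_, m).
Proof.
apply/matrixP => i j; rewrite !mxE -[RHS](congr1 _ (card_edge (enum_val i))).
rewrite -sum_mem_enum_val.
by apply: eq_bigr => l _; rewrite !mxE mulr1.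
Qed.

(** The entry at [e], [f] counts their common vertices: 2 on the diagonal, and at most 1 off it,
    since two edges sharing both ends coincide. *)
Lemma incmx_mul_tr (G : sgraph) :
  incmx G *m (incmx G)^T = 2%:M + adjmx R (line_graph G).
Proof.
apply/matrixP => i j; rewrite !mxE.
set e : edge G := enum_val i; set f : edge G := enum_val j.
have -> : \sum_l incmx G i l * (incmx G)^T l j = #|val e :&: val f|%:R.
  rewrite -sum_mem_enum_val; apply: eq_bigr => l _.
  by rewrite !mxE -natrM mulnb in_setI.
rewrite -(inj_eq enum_val_inj) -/e -/f /= /line_adj.
case: eqVneq => [->|eDf] /=; first by rewrite setIid card_edge addr0.
rewrite add0r; congr (_%:R); rewrite -card_gt0.
have : (#|val e :&: val f| < 2)%N; last by case: #|_| => [|[|]].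
rewrite ltnNge; apply: contra eDf => le2; rewrite -val_eqE eqEcard !card_edge.
rewrite leqnn andbT; apply/setIidPl/eqP.
by rewrite eqEcard subsetIl card_edge.
Qed.

(** If [v *m K *m K^T = 0], then the sum of squares of the entries of [v *m K] vanishes, so
    [v *m K = 0] and [v = 0]. *)
Lemma gram_unit m n (K : 'M[R]_(m, n)) : row_free K -> K *m K^T \in unitmx.
Proof.
move=> Kfree; rewrite -row_free_unit -kermx_eq0; apply/rowV0P => v /sub_kermxP.
rewrite mulmxA => /(congr1 (mulmx^~ v^T)); rewrite mul0mx -mulmxA -trmx_mul.
move=> /matrixP/(_ 0 0); rewrite !mxE => /eqP.
rewrite psumr_eq0 => [|i _]; last by rewrite [_^T _ _]mxE -expr2 sqr_ge0.
move=> /allP vK0; apply/eqP; rewrite -(mulmx_free_eq0 v Kfree).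
apply/eqP/rowP => i.
have := vK0 i (mem_index_enum i).
by rewrite [_^T _ _]mxE mulf_eq0 orbb [RHS]mxE => /eqP.
Qed.

Lemma tr_const_mx m n (a : R) : (const_mx a : 'M_(m, n))^T = const_mx a.
Proof. by apply/matrixP => i j; rewrite !mxE. Qed.

Lemma mul_const_mx m n p (a b : R) :
  (const_mx a : 'M[R]_(m, n)) *m (const_mx b : 'M_(n, p)) =
    const_mx (n%:R * (a * b)).
Proof.
apply/matrixP => i j; rewrite !mxE.
under eq_bigr do rewrite !mxE.
by rewrite sumr_const card_ord mulr_natl.
Qed.

(* The bound is tr (A M) for the reflection M = 2 P - 1, where P projects
   orthogonally onto the span of the rows of K and the all-ones vector. *)
Lemma energy_ge_fixed (m n : nat) (A : 'M[R]_n) (K : 'M[R]_(m, n)) :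
  (0 < n)%N -> A^T = A -> \tr A = 0 -> row_free K -> K *m A = K ->
  K *m (const_mx 1 : 'cV_n) = 0 ->
  2 * (m%:R + ((const_mx 1 : 'rV_n) *m A *m (const_mx 1 : 'cV_n)) 0 0 / n%:R)
    <= \sum_(x <- eigenvalues A) `|x|.
Proof.
move=> n0 Asym trA Kfree KA K1.
have nN0 : n%:R != 0 :> R by rewrite pnatr_eq0 -lt0n.
have Gu := gram_unit Kfree; set Gm := K *m K^T in Gu.
have Gsym : Gm^T = Gm by rewrite /Gm trmx_mul trmxK.
pose J : 'M[R]_n := const_mx 1.
have JE : J = (const_mx 1 : 'cV_n) *m (const_mx 1 : 'rV_n) by rewrite mul_const_mx !mul1r.
have JJ : J *m J = n%:R *: J.
  by rewrite mul_const_mx; apply/matrixP => i j; rewrite !mxE !mulr1.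
have Jsym : J^T = J by rewrite tr_const_mx.
have KJ : K *m J = 0 by rewrite JE mulmxA K1 mul0mx.
(* [Q] projects orthogonally onto the row space of [K], and [n%:R^-1 *: J] onto the all-ones line.
   These spaces are orthogonal by [K1], so the sum [P] is again a projection. *)
pose Q := K^T *m invmx Gm *m K.
have Qsym : Q^T = Q by rewrite /Q !trmx_mul trmxK trmx_inv Gsym mulmxA.
have QQ : Q *m Q = Q.
  rewrite /Q !mulmxA -(mulmxA _ K K^T) -/Gm -(mulmxA _ (invmx Gm) Gm).
  by rewrite mulVmx // mulmx1.
have QJ : Q *m J = 0 by rewrite /Q -mulmxA KJ mulmx0.
have JQ : J *m Q = 0 by rewrite -[RHS]trmx0 -QJ trmx_mul Qsym Jsym.
pose P := n%:R^-1 *: J + Q.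
have PP : P *m P = P.
  rewrite /P mulmxDl !mulmxDr QQ -!scalemxAl -!scalemxAr JJ QJ JQ !scaler0.
  by rewrite addr0 add0r !scalerA mulfVK.
have Psym : P^T = P by rewrite /P linearD linearZ /= Jsym Qsym.
pose M := 2 *: P - 1%:M.
have MM : M *m M^T = 1%:M.
  rewrite [M^T]linearB linearZ /= Psym trmx1 mulmxBl mulmxBr mulmx1 mul1mx.
  rewrite -scalemxAl -scalemxAr PP scalerA mulr2n mulrDl mul1r scalerDl.
  by rewrite addrK opprB addrC subrK.
apply: le_trans (trace_orthogonal_le Asym MM).
rewrite /M mulmxBr mulmx1 linearB /= trA subr0 -scalemxAr linearZ /=.
rewrite /P mulmxDr linearD /= -scalemxAr linearZ /= addrC.
(* [A] fixes the rows of [K], so this trace is that of [Q], namely its rank [m]. *)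
suff -> : \tr (A *m Q) = m%:R.
  by rewrite JE mulmxA mxtrace_mulC mulmxA trace_mx11 [_^-1 * _]mulrC.
rewrite mxtrace_mulC /Q -(mulmxA _ K A) KA mxtrace_mulC mulmxA -/Gm mulmxV //.
by rewrite mxtrace1.
Qed.

Lemma hyperenergetic_complement_line (H : sgraph) :
  (2 * graph_order H <= graph_order (line_graph H))%N ->
  lambda1 R (line_graph H) <= ((graph_order (line_graph H))%:R - 1) / 2 ->
  hyperenergetic R (complement (line_graph H)).
Proof.
set N := graph_order (line_graph H) => leN hlam.
rewrite /hyperenergetic /energy.
rewrite -[graph_order (complement _)]/N.
(* For [N = 0] the threshold [2 * (N - 1)] is -2, below any energy. *)
have [N0|Npos] := posnP N.
  apply: (@lt_le_trans _ _ 0); last by apply: sumr_ge0.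
  by rewrite N0 mulr0n; lra.
pose B := incmx H; pose K := row_base (kermx B).
have KB : K *m B = 0 by apply/sub_kermxP; rewrite eq_row_base.
have K1 p : K *m (const_mx 1 : 'M_(_, p)) = 0.
  have : K *m (B *m const_mx 1) = 0 :> 'M_(_, p) by rewrite mulmxA KB mul0mx.
  have -> : B *m const_mx 1 = 2 *: const_mx 1 :> 'M_(_, p).
    by rewrite incmx_const1; apply/matrixP => i j; rewrite !mxE mulr1.
  by rewrite -scalemxAr => /eqP; rewrite scaler_eq0 pnatr_eq0 /= => /eqP.
pose A := adjmx R (line_graph H).
(* With J the all-ones matrix, the complement is J - 1 - [A]; [K] kills J and [K *m A = -2 K], which
   leaves [- K + 2 K = K]. *)
have KA : K *m adjmx R (complement (line_graph H)) = K.
  rewrite adjmx_complement -/A.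
  have -> : A = B *m B^T - 2%:M by rewrite incmx_mul_tr addrC addKr.
  rewrite !mulmxBr K1 mulmxA KB mul0mx mulmx1 mul_mx_scalar.
  by rewrite !sub0r opprK scaler_nat mulr2n addKr.
pose cL := complement (line_graph H).
have := energy_ge_fixed Npos (adjmx_sym cL) (adjmx_tr0 cL) (row_base_free _) KA (K1 _).
apply: lt_le_trans.
rewrite mxrank_ker -/N.
set s := (_ *m _ *m _) 0 0.
have sE : s = N%:R * (N%:R - 1) -
    ((const_mx 1 : 'rV_N) *m A *m (const_mx 1 : 'rV_N)^T) 0 0.
  have entryB (X Y : 'M[R]_1) : (X - Y) 0 0 = X 0 0 - Y 0 0 by rewrite !mxE.
  rewrite /s adjmx_complement tr_const_mx !mulmxBr !mulmxBl mulmx1 !entryB.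
  by rewrite !mul_const_mx ![const_mx _ _ _]mxE !mulr1 mulrBr mulr1.
have := @quadratic_form_le R N A (const_mx 1) (adjmx_sym _).
rewrite tr_const_mx mul_const_mx [const_mx _ _ _]mxE !mulr1.
rewrite tr_const_mx in sE.
move: sE; set t := (_ *m _ *m _) 0 0 => sE tle.
have rk : (\rank B <= graph_order H)%N by apply: rank_leq_col.
(* The kernel of [B] has dimension [N - \rank B], at least N - |H|, and 2 |H| <= N. *)
have rN : (N <= 2 * (N - \rank B))%N by lia.
have {}rN : N%:R <= 2 * (N - \rank B)%:R :> R by rewrite -natrM ler_nat.
have NR : 0 < N%:R :> R by rewrite ltr0n.
have sN : (N%:R - 1) / 2 <= s / N%:R.
  rewrite ler_pdivlMr // sE mulrC.
  have : t <= (N%:R - 1) / 2 * N%:R.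
    by apply: le_trans tle _; rewrite ler_wpM2r // ler0n.
  by lra.
(* The two bounds add up to 2 N - 1, one more than the threshold. *)
by lra.
Qed.

End Matrices.

Theorem theorem5p9 (R : rcfType) (G : sgraph) (k : nat)
    (hdeg : forall u v : vertex G, adj u v -> (6 <= degree u + degree v)%N)
    (hk : (2 <= k)%N)
    (hlambda : lambda1 R (iter_line_graph k G)
                 <= ((graph_order (iter_line_graph k G))%:R - 1) / 2) :
  hyperenergetic R (complement (iter_line_graph k G)).
Proof.
(* Since [k] is at least 2, the graph whose line graph is taken last is itself a line graph, so its
   degrees are at least 4. *)
case: k hk hlambda => [|[|k]] // _; apply: hyperenergetic_complement_line.
exact: line_order_ge (iter_line_degree_ge4 hdeg).
Qed.
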